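(* Let $A$ be an integral domain whose fraction field $\mathcal{K}(A)$ is formally real, and let $\mathcal{C}=A\cap\sum\mathcal{K}(A)^2$. Assume that the stability index satisfies $\operatorname{s}(\operatorname{Spec}_rA\setminus\operatorname{Spec}_cA)\leq 1$. Let $f_1,\ldots,f_r\in A$, $f\in A$, and let $\overline{\mathcal{S}}^c(f_1,\ldots,f_r)=\{\alpha\in\operatorname{Spec}_cA\mid f_1(\alpha)\geq 0,\ldots,f_r(\alpha)\geq 0\}$. Then: (1) $f\geq 0$ on $\overline{\mathcal{S}}^c(f_1,\ldots,f_r)$ if and only if $fq=p+f^{2m}$ for some $p,q\in\mathcal{C}[f_1,\ldots,f_r]$ and $m\in\mathbb{N}$. (2) $f>0$ on $\overline{\mathcal{S}}^c(f_1,\ldots,f_r)$ if and only if $fq=1+p$ for some $p,q\in\mathcal{C}[f_1,\ldots,f_r]$. (3) $f=0$ on $\overline{\mathcal{S}}^c(f_1,\ldots,f_r)$ if and only if $f^{2m}+p=0$ for some $p\in\mathcal{C}[f_1,\ldots,f_r]$ and $m\in\mathbb{N}$.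
   Context: All rings are commutative and contain $\mathbb{Q}$. A field is formally real if $-1$ is not a sum of squares. $\sum\mathcal{K}(A)^2$ is the set of sums of squares of $\mathcal{K}(A)$. A cone of a ring $B$ is a subset $P\subset B$ with $P+P\subset P$, $P\cdot P\subset P$ and $b^2\in P$ for all $b\in B$; it is proper if $-1\notin P$. $\mathcal{C}[f_1,\ldots,f_r]$ is the smallest cone of $A$ containing $\mathcal{C}$ and $f_1,\ldots,f_r$. An ordering of $B$ is a proper cone $P$ such that $ab\in P$ implies $a\in P$ or $-b\in P$; $\operatorname{Spec}_rB$ is the set of orderings of $B$. For $\alpha\in\operatorname{Spec}_rA$, write $P_\alpha$ for the corresponding cone and $\operatorname{supp}(\alpha)=P_\alpha\cap -P_\alpha$; $a(\alpha)\geq 0$ means $a\in P_\alpha$, $a(\alpha)>0$ means $a\in P_\alpha\setminus\operatorname{supp}(\alpha)$, $a(\alpha)=0$ means $a\in\operatorname{supp}(\alpha)$. Basic open sets are the sets $\mathcal{S}(f_1,\ldots,f_k)=\{\alpha\in\operatorname{Spec}_rA\mid f_1(\alpha)>0,\ldots,f_k(\alpha)>0\}$; they generate the topology of $\operatorname{Spec}_rA$. The map $Q\mapsto Q\cap A$ identifies $\operatorname{Spec}_r\mathcal{K}(A)$ with the set of orderings of $A$ with support $(0)$; $\operatorname{Spec}_cA:=\overline{\operatorname{Spec}_r\mathcal{K}(A)}$ (closure in $\operatorname{Spec}_rA$). The stability index $\operatorname{s}(U)$ of an open subset $U$ of $\operatorname{Spec}_rA$ is the infimum of the $k\in\mathbb{N}$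 such that every basic open set $S\subset U$ can be written $S=\mathcal{S}(f_1,\ldots,f_k)$ for some $f_1,\ldots,f_k\in A$; $\operatorname{s}(\emptyset)=0$. *)

(* Defs.v *)
From HB Require Import structures.
From mathcomp Require Import all_boot all_order all_algebra.
From mathcomp Require Import mathcomp_extra boolp classical_sets functions.
From mathcomp Require Import constructive_ereal ereal topology.
Set Implicit Arguments.
Unset Strict Implicit.
Unset Printing Implicit Defensive.
Import Order.TTheory GRing.Theory Num.Theory.
Local Open Scope classical_set_scope.
Local Open Scope ring_scope.

Definition contains_rat (B : unitRingType) : Prop :=
  forall n : nat, (n.+1%:R : B) \is a GRing.unit.

Definition sums_of_squares (B : comNzRingType) : set B :=
  [set x | exists s : seq B, x = \sum_(b <- s) b ^+ 2].

Definition formally_real (K : fieldType) : Prop :=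
  ~ sums_of_squares (-1 : K).

Definition is_cone (B : comNzRingType) (P : set B) : Prop :=
  [/\ forall a b, P a -> P b -> P (a + b),
      forall a b, P a -> P b -> P (a * b)
    & forall b, P (b ^+ 2)].

(* The cone C[f_1, ..., f_r]. *)
Definition cone_adjoin (B : comNzRingType) (C : set B) (r : nat)
    (f : 'I_r -> B) : set B :=
  smallest (@is_cone B) (C `|` range f).

Definition is_ordering (B : comNzRingType) (P : set B) : Prop :=
  [/\ is_cone P, ~ P (-1) & forall a b, P (a * b) -> P a \/ P (- b)].

Record realSpec (B : comNzRingType) := RealSpec {
  ordering_cone : set B;
  ordering_coneP : is_ordering ordering_cone }.

Section RealSpectrum.
Context {B : comNzRingType}.
Implicit Types alpha : realSpec B.

Definition ord_supp alpha : set B :=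
  [set a | ordering_cone alpha a /\ ordering_cone alpha (- a)].

Definition ord_ge0 alpha (a : B) : Prop := ordering_cone alpha a.
Definition ord_gt0 alpha (a : B) : Prop :=
  (ordering_cone alpha `\` ord_supp alpha) a.
Definition ord_eq0 alpha (a : B) : Prop := ord_supp alpha a.

Definition basic_set (k : nat) (f : 'I_k -> B) : set (realSpec B) :=
  [set alpha | forall i, ord_gt0 alpha (f i)].

Definition basic_open : set (set (realSpec B)) :=
  [set S | exists (k : nat) (f : 'I_k -> B), S = basic_set f].

End RealSpectrum.

HB.instance Definition _ (B : comNzRingType) := gen_eqMixin (realSpec B).
HB.instance Definition _ (B : comNzRingType) := gen_choiceMixin (realSpec B).
HB.instance Definition _ (B : comNzRingType) :=
  isSubBaseTopological.Build (realSpec B) (@basic_open B) id.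

Section Pullback.
Variables (A B : comNzRingType) (phi : {rmorphism A -> B}).

Lemma is_ordering_preimage (Q : set B) :
  is_ordering Q -> is_ordering (phi @^-1` Q).
Proof.
case=> -[QD QM Qsq] Q1 Qor; split; first split.
- by move=> a b /= Qa Qb; rewrite rmorphD; exact: QD.
- by move=> a b /= Qa Qb; rewrite rmorphM; exact: QM.
- by move=> b /=; rewrite rmorphXn; exact: Qsq.
- by rewrite /= rmorphN rmorph1.
- by move=> a b /=; rewrite rmorphM rmorphN; exact: Qor.
Qed.

Definition realSpec_pullback (Q : realSpec B) : realSpec A :=
  RealSpec (is_ordering_preimage (ordering_coneP Q)).

End Pullback.

Section CentralSpectrum.
Variable A : idomainType.

(* The orderings Q \cap A, for Q an ordering of the fraction field. *)
Definition fraction_realSpec : set (realSpec A) :=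
  range (realSpec_pullback (@FracField.tofrac A)).

Definition central_realSpec : set (realSpec A) := closure fraction_realSpec.

Definition central_cone : set A :=
  @FracField.tofrac A @^-1` @sums_of_squares {fraction A}.

Definition central_basic_closed (r : nat) (f : 'I_r -> A) : set (realSpec A) :=
  [set alpha | central_realSpec alpha /\ forall i, ord_ge0 alpha (f i)].

End CentralSpectrum.

Arguments fraction_realSpec : clear implicits.
Arguments central_realSpec : clear implicits.
Arguments central_cone : clear implicits.

(* The infimum is taken in the rationals extended with -oo and +oo, so that it
   is +oo when no k works. The case U = set0 is a convention: set0 is basic
   open, and it is not of the form basic_set f with f the empty family unless
   the real spectrum is empty. *)
Definition stability_index (B : comNzRingType) (U : set (realSpec B)) :
    \bar rat :=
  if `[< U = set0 >] then 0%E else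
  ereal_inf [set k%:R%:E | k in [set k : nat |
    forall S, basic_open S -> S `<=` U ->
      exists f : 'I_k -> B, S = basic_set f]].

(* Main.v *)
Require Import Defs.
From HB Require Import structures.
From mathcomp Require Import all_boot all_order all_algebra.
From mathcomp Require Import mathcomp_extra boolp classical_sets functions.
From mathcomp Require Import constructive_ereal ereal topology finmap.
From mathcomp Require Import ring.
Set Implicit Arguments.
Unset Strict Implicit.
Unset Printing Implicit Defensive.
Import Order.TTheory GRing.Theory Num.Theory.
Local Open Scope classical_set_scope.
Local Open Scope ring_scope.

(** The three equivalences are the abstract Positivstellensatz for the cone
    [C[g]], once the orderings of [A] that contain [C] are known to be exactly
    the central ones ([central_realSpecP]); the hypothesis on the stability
    index serves only there.

    Every central ordering contains [C], because an open condition [c < 0] at a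
    central point would be met by an ordering of the fraction field, in which
    [c] is a sum of squares.  Conversely let [alpha] be a non-central ordering.
    The complement of the closed set of central orderings has stability index at
    most 1, so some basic open neighbourhood of [alpha] missing the central
    orderings is given by a single inequality [h > 0].  Then [- h] is
    nonnegative at every ordering of the fraction field, so it is a sum of
    squares there by Artin's theorem ([nonneg_sums_of_squares]).  Hence [- h]
    lies in [C] while [- h] is negative at [alpha], and [alpha] does not
    contain [C].

    For the Positivstellensatz, the only existence principle is
    [exists_ordering]: a cone without any element [- u ^+ (2 * m)] extends to an
    ordering at which [u] does not vanish.  If there is no certificate for
    [f >= 0], [f > 0] or [f = 0], this principle applies to [C[g]]
    with [- f] adjoined and [u = f], to [C[g]] with [- f] adjoined and [u = 1],
    and to [C[g]] and [u = f] respectively, and it produces a central ordering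
    that violates the corresponding sign condition. *)

(** * Cones *)

Section Cones.
Context {B : comNzRingType}.
Implicit Types (P T : set B) (a b u : B).

Lemma cone0 P : is_cone P -> P 0.
Proof. by case=> _ _ /(_ 0); rewrite expr0n. Qed.

Lemma cone1 P : is_cone P -> P 1.
Proof. by case=> _ _ /(_ 1); rewrite expr1n. Qed.

Lemma cone_even_exp P u m : is_cone P -> P (u ^+ (2 * m)).
Proof. by case=> _ _; rewrite mulnC exprM; apply. Qed.

Lemma sums_of_squares_cone : is_cone (@sums_of_squares B).
Proof.
split.
- by move=> _ _ [s ->] [t ->]; exists (s ++ t); rewrite big_cat.
- move=> _ _ [s ->] [t ->]; exists [seq x * y | x <- s, y <- t].
  rewrite big_allpairs_dep /= mulr_suml; apply: eq_bigr => x _.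
  by rewrite mulr_sumr; apply: eq_bigr => y _; rewrite exprMn.
- by move=> b; exists [:: b]; rewrite big_seq1.
Qed.

Lemma cone_adjoin_cone (C : set B) r (g : 'I_r -> B) :
  is_cone (cone_adjoin C g).
Proof.
split.
- move=> a b Ca Cb P [coneP CP].
  by case: (coneP) => PD _ _; apply: PD; [exact: Ca | exact: Cb].
- move=> a b Ca Cb P [coneP CP].
  by case: (coneP) => _ PM _; apply: PM; [exact: Ca | exact: Cb].
- by move=> b P [[_ _ Psq] CP].
Qed.

Definition adjoin1 T a : set B :=
  [set x | exists p q, [/\ T p, T q & x = p + a * q]].

Lemma adjoin1_cone T a : is_cone T -> is_cone (adjoin1 T a).
Proof.
move=> coneT; have T0 := cone0 coneT; case: coneT => TD TM Tsq; split.
- move=> _ _ [p [q [Tp Tq ->]]] [p' [q' [Tp' Tq' ->]]].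
  by exists (p + p'), (q + q'); split; [exact: TD | exact: TD | ring].
- move=> _ _ [p [q [Tp Tq ->]]] [p' [q' [Tp' Tq' ->]]].
  exists (p * p' + a ^+ 2 * (q * q')), (p * q' + q * p'); split; last by ring.
    by apply: (TD); [exact: TM | apply: (TM); [exact: Tsq | exact: TM]].
  by apply: TD; exact: TM.
- by move=> b; exists (b ^+ 2), 0; split => //; ring.
Qed.

Lemma sub_adjoin1 T a : is_cone T -> T `<=` adjoin1 T a.
Proof.
by move=> coneT x Tx; exists x, 0; split=> //; [exact: cone0 | ring].
Qed.

Lemma mem_adjoin1 T a : is_cone T -> adjoin1 T a a.
Proof.
move=> coneT; exists 0, 1.
by split; [exact: cone0 | exact: cone1 | ring].
Qed.

(** The role of a multiplicative set disjoint from an ideal is played here by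
    the even powers of [u]; for [u = 1] the condition says that [P] is proper. *)
Definition avoids_neg_even_powers u P := forall m, ~ P (- u ^+ (2 * m)).

(** Zorn's lemma; a union of a chain of cones is a cone because two of its
    elements already lie in one member of the chain. *)
Lemma maximal_avoiding_cone T u :
  is_cone T -> avoids_neg_even_powers u T ->
  exists P, [/\ is_cone P, avoids_neg_even_powers u P, T `<=` P &
    forall Q, is_cone Q -> avoids_neg_even_powers u Q -> P `<=` Q -> Q `<=` P].
Proof.
move=> coneT Tu.
(* Unions with [T], so that the empty chain also has an upper bound. *)
pose good (X : set B) :=
  is_cone (T `|` X) /\ avoids_neg_even_powers u (T `|` X).
have chain_good F : F `<=` good -> total_on F subset ->
    good (\bigcup_(X in F) X).
  move=> Fgood Ftot.
  pose U := T `|` \bigcup_(X in F) X.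
  have UE x y : U x -> U y -> (T x /\ T y) \/
      exists X, [/\ F X, (T `|` X) x & (T `|` X) y].
    case=> [Tx|[X FX Xx]] [Ty|[Y FY Yy]]; first by left.
    - by right; exists Y; split=> //; [left | right].
    - by right; exists X; split=> //; [right | left].
    - right; case: (Ftot _ _ FX FY) => XY.
        by exists Y; split=> //; right => //; exact: XY.
      by exists X; split=> //; right => //; exact: XY.
  have sU X : F X -> T `|` X `<=` U.
    by move=> FX x [Tx|Xx]; [left | right; exists X].
  split; first split.
  - move=> a b Ua Ub; case: (UE _ _ Ua Ub) => [[Ta Tb]|[X [FX Xa Xb]]].
      by left; case: coneT => TD _ _; exact: TD.
    apply: (sU X FX); case: (Fgood _ FX) => -[XD _ _] _; exact: XD.
  - move=> a b Ua Ub; case: (UE _ _ Ua Ub) => [[Ta Tb]|[X [FX Xa Xb]]].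
      by left; case: coneT => _ TM _; exact: TM.
    apply: (sU X FX); case: (Fgood _ FX) => -[_ XM _] _; exact: XM.
  - by move=> b; left; case: coneT.
  - move=> m [Tm|[X FX Xm]]; first exact: (Tu m).
    by case: (Fgood _ FX) => _ /(_ m); apply; right.
have [M [[coneM Mu] maxM]] := Zorn_bigcup chain_good.
exists (T `|` M); split=> // Q coneQ Qu sQ x Qx.
apply: contrapT => nx; apply: (maxM Q).
  split=> [y My|QM]; first by apply: sQ; right.
  by apply: nx; right; exact: QM.
have -> : good Q = (is_cone Q /\ avoids_neg_even_powers u Q).
  rewrite /good; suff -> : T `|` Q = Q by [].
  by apply/seteqP; split=> [y [Ty|//]|y Qy]; [apply: sQ; left | right].
by [].
Qed.

(** A maximal avoiding cone is prime, like an ideal maximal among those disjoint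
    from a multiplicative set.  If [a * b] lies in a maximal avoiding cone [P]
    but neither [a] nor [- b] does, adjoining either one yields identities
    [- u ^+ (2 * m) = p + a * q] and [- u ^+ (2 * n) = p' - b * q'];
    multiplying [- a * q] by [b * q'] then puts [- u ^+ (2 * (m + n))] in
    [P]. *)
Lemma exists_ordering T u :
  is_cone T -> avoids_neg_even_powers u T ->
  exists alpha : realSpec B,
    T `<=` ordering_cone alpha /\ ~ ord_supp alpha u.
Proof.
move=> coneT Tu.
have [P [coneP Pu sTP maxP]] := maximal_avoiding_cone coneT Tu.
have adjoin_meets a : ~ P a -> exists m, adjoin1 P a (- u ^+ (2 * m)).
  move=> nPa; apply: contrapT => nex; apply: nPa.
  apply: (maxP (adjoin1 P a)); first exact: adjoin1_cone.
  - by move=> m Pm; apply: nex; exists m.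
  - exact: sub_adjoin1.
  - exact: mem_adjoin1.
case: (coneP) => PD PM Psq.
have ordP : is_ordering P.
  split=> //; first by have := Pu 0; rewrite muln0 expr0.
  move=> a b Pab; apply: contrapT => /not_orP[nPa nPb].
  have [m [p [q [Pp Pq Em]]]] := adjoin_meets _ nPa.
  have [n [p' [q' [Pp' Pq' En]]]] := adjoin_meets _ nPb.
  apply: (Pu (m + n)%N).
  have -> : - u ^+ (2 * (m + n)) =
      (a * b) * (q * q') + u ^+ (2 * m) * p' + u ^+ (2 * n) * p + p * p'.
    rewrite mulnDr exprD.
    have -> : u ^+ (2 * m) = - (p + a * q) by rewrite -Em opprK.
    have -> : u ^+ (2 * n) = - (p' + - b * q') by rewrite -En opprK.
    ring.
  apply: (PD); [apply: (PD); [apply: (PD) |] |].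
  - by apply: (PM) => //; exact: PM.
  - by apply: (PM) => //; exact: cone_even_exp.
  - by apply: (PM) => //; exact: cone_even_exp.
  - exact: PM.
exists (RealSpec ordP); split=> // -[/= uP nuP].
apply: (Pu 1%N); rewrite muln1.
by rewrite (_ : - u ^+ 2 = u * - u); [exact: PM | ring].
Qed.

End Cones.

(** * Signs at an ordering *)

Section Signs.
Context {B : comNzRingType}.
Implicit Types (alpha : realSpec B) (a b u : B).

Lemma ord_cone alpha : is_cone (ordering_cone alpha).
Proof. by case: alpha => P []. Qed.

Lemma ord_proper alpha : ~ ordering_cone alpha (-1).
Proof. by case: alpha => P []. Qed.

Lemma ord_prime alpha a b :
  ordering_cone alpha (a * b) ->
  ordering_cone alpha a \/ ordering_cone alpha (- b).
Proof. by case: alpha => P [? ? H]; exact: H. Qed.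

Lemma ord_total alpha a : ordering_cone alpha a \/ ordering_cone alpha (- a).
Proof. by apply: ord_prime; case: (ord_cone alpha) => _ _; exact. Qed.

Lemma ord_gt0N alpha a : ~ ordering_cone alpha (- a) -> ord_gt0 alpha a.
Proof. by move=> na; split=> [|[]//]; case: (ord_total alpha a). Qed.

Lemma ord_gt0_not alpha a : ord_gt0 alpha a -> ~ ordering_cone alpha (- a).
Proof. by move=> [pa na] pna; apply: na. Qed.

(** Primeness peels the factors [a] off [a ^+ (2 * m)] one at a time, and
    [-1] cannot be reached. *)
Lemma ord_ge0_neg_even_exp alpha a m :
  ordering_cone alpha (- a ^+ (2 * m)) -> ordering_cone alpha a.
Proof.
elim: m => [|m IHm]; first by rewrite muln0 expr0 => /ord_proper.
have -> : - a ^+ (2 * m.+1) = a * - (a * a ^+ (2 * m)).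
  by rewrite mulnS exprD; ring.
by move=> /ord_prime[//|]; rewrite opprK => /ord_prime[].
Qed.

End Signs.

(** * Basic open sets form a base *)

Section Base.
Context {B : comNzRingType}.
Implicit Types (alpha : realSpec B) (S N : set (realSpec B)).

Lemma basic_openI S S' : basic_open S -> basic_open S' -> basic_open (S `&` S').
Proof.
move=> [k [f ->]] [l [g ->]].
exists (k + l)%N,
  (fun i => match fintype.split i with inl j => f j | inr j => g j end).
apply/seteqP; split=> [alpha [fa ga] i|alpha fga].
  by case: (fintype.split i).
split=> i.
  by have := fga (unsplit (inl i)); rewrite unsplitK.
by have := fga (unsplit (inr i)); rewrite unsplitK.
Qed.

Lemma basic_openT : basic_open [set: realSpec B].
Proof.
exists 0%N, (fun=> 0); by apply/seteqP; split=> // alpha _ [].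
Qed.

Lemma basic_open_bigcap (E : {fset set (realSpec B)}) :
  {subset E <= @basic_open B} -> basic_open (\bigcap_(S in [set` E]) S).
Proof.
move=> Eb; rewrite bigcap_fset big_seq.
apply: (big_ind (@basic_open B)); first exact: basic_openT.
  exact: basic_openI.
by move=> S /Eb /set_mem.
Qed.

(** The generated topology consists of unions of finite intersections of basic
    open sets, and finite intersections only concatenate lists of inequalities. *)
Lemma nbhs_basic_open alpha N :
  nbhs alpha N <-> exists S, [/\ basic_open S, S alpha & S `<=` N].
Proof.
split=> [[O [[D Dsub <-] [S DS Sa] sON]]|[S [Sb Sa sSN]]].
  exists S; split=> //; last by move=> beta Sbeta; apply: sON; exists S.
  by have [E Eb <-] := Dsub _ DS; exact: basic_open_bigcap.
exists S; split=> //; exists [set S]; last by rewrite bigcup_set1.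
by move=> _ ->; exact: finI_from1.
Qed.

End Base.

(** * Central orderings *)

(** Artin's theorem.  Otherwise adjoining [- a] to the cone of sums of squares
    leaves it proper, and it extends to an ordering at which [a < 0]: if
    [- 1 = s - a * t] with [s] and [t] sums of squares, then [t != 0]
    because [K] is formally real, and
    [a = (1 + s) / t = (1 + s) * t * t^-1 ^+ 2] would be a sum of squares. *)
Lemma nonneg_sums_of_squares (K : fieldType) (a : K) :
  formally_real K -> (forall alpha : realSpec K, ordering_cone alpha a) ->
  sums_of_squares a.
Proof.
move=> realK a_ge0; apply: contrapT => na.
have coneS := @sums_of_squares_cone K.
have [|m|alpha [sSa _]] :=
  @exists_ordering K (adjoin1 (@sums_of_squares K) (- a)) 1.
- exact: adjoin1_cone.
- rewrite expr1n => -[s [t [Ss St E]]]; case: (coneS) => SD SM Ssq.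
  have t0 : t != 0.
    by apply: contra_notN realK => /eqP t0; rewrite E t0 mulr0 addr0.
  apply: na; have -> : a = (1 + s) * t * t^-1 ^+ 2.
    have -> : 1 + s = a * t by rewrite -[1]opprK E; ring.
    by field.
  by apply: (SM) => //; apply: (SM) => //; apply: (SD) => //; exact: cone1.
have a0 : a != 0 by apply: contra_notN na => /eqP ->; exact: cone0.
case: (ord_cone alpha) => _ PM Psq; apply: (@ord_proper _ alpha).
have -> : -1 = - a * a * a^-1 ^+ 2 by field.
apply: (PM) => //; apply: (PM) => //; apply: sSa; exact: mem_adjoin1.
Qed.

(** The defining set consists of integers, so an infimum below 2 is
    witnessed by some [k <= 1]. *)
Lemma stability_index_le1 (B : comNzRingType) (U : set (realSpec B)) :
  U !=set0 -> (stability_index U <= 1%:E)%E ->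
  exists2 k, (k <= 1)%N & forall S, basic_open S -> S `<=` U ->
    exists f : 'I_k -> B, S = basic_set f.
Proof.
move=> U0; rewrite /stability_index; case: asboolP => [UE|_ le1].
  by case: U0 => x; rewrite UE.
have : (ereal_inf [set (k%:R : rat)%:E | k in [set k : nat |
    forall S, basic_open S -> S `<=` U ->
      exists f : 'I_k -> B, S = basic_set f]] < 2%:E)%E.
  by apply: le_lt_trans le1 _; rewrite lte_fin.
move=> /ereal_inf_lt[_ [k Hk <-]]; rewrite lte_fin ltr_nat ltnS => k1.
by exists k.
Qed.

Section Central.
Variable A : idomainType.
Hypothesis realA : formally_real {fraction A}.

Let tofrac := @FracField.tofrac A.

Lemma fraction_realSpec_neq0 : fraction_realSpec A !=set0.
Proof.
have [|m|alpha _] := @exists_ordering {fraction A} (@sums_of_squares _) 1.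
- exact: sums_of_squares_cone.
- by rewrite expr1n.
- by exists (realSpec_pullback tofrac alpha), alpha.
Qed.

Lemma sums_of_squares_sub_ordering (B : comNzRingType) (alpha : realSpec B) :
  @sums_of_squares B `<=` ordering_cone alpha.
Proof.
case: (ord_cone alpha) => PD _ Psq _ [s ->].
apply: big_ind => //; exact: cone0 (ord_cone alpha).
Qed.

(** An element [c] negative at [alpha] is negative on a neighbourhood of
    [alpha], hence at some ordering of the fraction field. *)
Lemma central_cone_sub_central alpha :
  central_realSpec A alpha -> central_cone A `<=` ordering_cone alpha.
Proof.
move=> calpha c Cc; apply: contrapT => nc.
pose S := basic_set (fun _ : 'I_1 => - c).
have /calpha[_ [[beta _ <-] /(_ ord0)]] : nbhs alpha S.
  apply/nbhs_basic_open; exists S; split=> //; first by exists 1%N, (fun=> - c).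
  by move=> i; apply: ord_gt0N; rewrite opprK.
move=> /ord_gt0_not; rewrite opprK; apply.
exact: (@sums_of_squares_sub_ordering _ beta _ Cc).
Qed.

Hypothesis stabA : (stability_index (~` central_realSpec A) <= 1%:E)%E.

(** The converse is where a single inequality is essential: only for one [h] is
    [h <= 0] at the orderings of the fraction field a condition to which
    Artin's theorem applies. *)
Lemma central_realSpecP alpha :
  central_realSpec A alpha <-> central_cone A `<=` ordering_cone alpha.
Proof.
split; first exact: central_cone_sub_central.
move=> sC; apply: contrapT => nalpha.
have [S [Sb Sa SF]] : exists S,
    [/\ basic_open S, S alpha & S `<=` ~` central_realSpec A].
  move: (nalpha) => /existsNP[N /not_implyP[]].
  move=> /nbhs_basic_open[S [Sb Sa sSN]] FN.
  exists S; split=> // beta Sbeta cbeta.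
  have /cbeta[gamma [Fg Sg]] : nbhs beta S.
    by apply/nbhs_basic_open; exists S; split.
  by apply: FN; exists gamma; split=> //; exact: sSN.
have sF : fraction_realSpec A `<=` central_realSpec A by exact: subset_closure.
have [|k k1 basicU] := stability_index_le1 _ stabA; first by exists alpha.
have {basicU}[h Sh] := basicU S Sb SF.
case: k k1 h Sh => [|[|k]] // _ h Sh.
  (* No inequality at all would describe the whole real spectrum. *)
  have [beta Fbeta] := fraction_realSpec_neq0.
  by apply: (SF beta); [rewrite Sh => -[] | exact: sF].
have Ch : central_cone A (- h ord0).
  apply: nonneg_sums_of_squares => // beta.
  apply: contrapT => nbeta.
  have Fbeta : fraction_realSpec A (realSpec_pullback tofrac beta).
    by exists beta.
  apply: (SF _ _ (sF _ Fbeta)); rewrite Sh => i; rewrite ord1.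
  exact: ord_gt0N.
by move: Sa; rewrite Sh => /(_ ord0)/ord_gt0_not; apply; exact: sC.
Qed.

Lemma central_basic_closedP r (g : 'I_r -> A) alpha :
  central_basic_closed g alpha <->
  cone_adjoin (central_cone A) g `<=` ordering_cone alpha.
Proof.
split=> [[calpha ga]|sC].
  apply: smallest_sub; first exact: ord_cone.
  by move=> x [Cx|[i _ <-]]; [exact: central_cone_sub_central Cx | exact: ga].
have sG : central_cone A `|` range g `<=` ordering_cone alpha.
  exact: subset_trans (@sub_gen_smallest _ _ _) sC.
split=> [|i]; last by apply: sG; right; exists i.
by apply/central_realSpecP => c Cc; apply: sG; left.
Qed.

End Central.

(** * The abstract Positivstellensatz *)

Section Positivstellensatz.
Variables (B : comNzRingType) (T : set B).
Hypothesis coneT : is_cone T.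
Implicit Types (alpha : realSpec B) (f : B).

(** An ordering with [f < 0] is one that contains [- f] and at which [f] does
    not vanish, so the certificate says that [- f ^+ (2 * m)] lies in the cone
    obtained by adjoining [- f]. *)
Lemma cone_nonneg f :
  (forall alpha, T `<=` ordering_cone alpha -> ord_ge0 alpha f) <->
  exists p q m, [/\ T p, T q & f * q = p + f ^+ (2 * m)].
Proof.
split=> [f_ge0|[p [q [m [Tp Tq E]]]] alpha sT].
  apply: contrapT => nex.
  have [|m [p [q [Tp Tq E]]]|alpha [sT f0]] :=
    @exists_ordering _ (adjoin1 T (- f)) f.
  - exact: adjoin1_cone.
  - apply: nex; exists p, q, m; split=> //.
    by rewrite -[_ ^+ _]opprK E; ring.
  - apply: f0; split; last by apply: sT; exact: mem_adjoin1.
    by apply: f_ge0 => x Tx; apply: sT; exact: sub_adjoin1.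
case: (ord_total alpha f) => // nf; apply: (@ord_ge0_neg_even_exp _ alpha f m).
case: (ord_cone alpha) => PD PM _.
have -> : - f ^+ (2 * m) = - f * q + p by rewrite mulNr E; ring.
by apply: (PD); [apply: (PM) => //|]; exact: sT.
Qed.

(** The certificate says that [-1] lies in the cone obtained by adjoining
    [- f]. *)
Lemma cone_pos f :
  (forall alpha, T `<=` ordering_cone alpha -> ord_gt0 alpha f) <->
  exists p q, [/\ T p, T q & f * q = 1 + p].
Proof.
split=> [f_gt0|[p [q [Tp Tq E]]] alpha sT].
  apply: contrapT => nex.
  have [|m|alpha [sT _]] := @exists_ordering _ (adjoin1 T (- f)) 1.
  - exact: adjoin1_cone.
  - rewrite expr1n => -[p [q [Tp Tq E]]]; apply: nex; exists p, q; split=> //.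
    by rewrite -[1]opprK E; ring.
  - have /f_gt0/ord_gt0_not : T `<=` ordering_cone alpha.
      by move=> x Tx; apply: sT; exact: sub_adjoin1.
    by apply; apply: sT; exact: mem_adjoin1.
apply: ord_gt0N => nf; apply: (@ord_proper _ alpha).
case: (ord_cone alpha) => PD PM _.
have -> : -1 = - f * q + p by rewrite mulNr E; ring.
by apply: (PD); [apply: (PM) => //|]; exact: sT.
Qed.

Lemma cone_zero f :
  (forall alpha, T `<=` ordering_cone alpha -> ord_eq0 alpha f) <->
  exists p m, T p /\ f ^+ (2 * m) + p = 0.
Proof.
split=> [f_eq0|[p [m [Tp E]]] alpha sT].
  apply: contrapT => nex.
  have [//|m Tm|alpha [sT]] := @exists_ordering _ T f; last first.
    by apply; exact: f_eq0.
  by apply: nex; exists (- f ^+ (2 * m)), m; rewrite subrr.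
have Pfm : ordering_cone alpha (- f ^+ (2 * m)).
  by move/eqP: E; rewrite addrC addr_eq0 => /eqP <-; exact: sT.
by split; apply: (@ord_ge0_neg_even_exp _ alpha _ m) => //;
  rewrite !exprM sqrrN -exprM.
Qed.

End Positivstellensatz.

Unset Implicit Arguments.

Theorem proposition5p6 (A : idomainType) (ratA : contains_rat A)
    (realA : formally_real {fraction A})
    (stabA : (stability_index (~` central_realSpec A) <= 1%:E)%E)
    (r : nat) (g : 'I_r -> A) (f : A) :
  let Cg := cone_adjoin (central_cone A) g in
  [/\ (forall alpha, central_basic_closed g alpha -> ord_ge0 alpha f) <->
        (exists (p q : A) (m : nat),
           [/\ Cg p, Cg q & f * q = p + f ^+ (2 * m)]),
      (forall alpha, central_basic_closed g alpha -> ord_gt0 alpha f) <->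
        (exists p q : A, [/\ Cg p, Cg q & f * q = 1 + p])
    & (forall alpha, central_basic_closed g alpha -> ord_eq0 alpha f) <->
        (exists (p : A) (m : nat), Cg p /\ f ^+ (2 * m) + p = 0)].
Proof.
move=> Cg; have coneCg : is_cone Cg by exact: cone_adjoin_cone.
have closedE (Q : realSpec A -> Prop) :
    (forall alpha, central_basic_closed g alpha -> Q alpha) <->
    (forall alpha, Cg `<=` ordering_cone alpha -> Q alpha).
  by split=> HQ alpha /(central_basic_closedP realA stabA g alpha); exact: HQ.
split; rewrite closedE.
- exact: cone_nonneg.
- exact: cone_pos.
- exact: cone_zero.
Qed.
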